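(* Let $k,n$ be positive integers and let $\mathcal{S}=\{S_1,\dots,S_k\}$ be a set system where $S_i\subseteq [n]$ for all $i\in [k]$. Suppose that for all $i\in [k]$ we have $|S_i|\leqslant i-1$. Then for any finite field $\mathbb{F}_q$ with $q\geqslant n+1$, there exists a $k\times n$ MDS matrix $A$ over $\mathbb{F}_q$ such that, for all $i\in[k]$ and $j\in[n]$, $A_{i,j}=0$ if and only if $j\in S_i$.
   Context: For a positive integer $n$, $[n]:=\{1,\dots,n\}$. $\mathbb{F}_q$ denotes the finite field with $q$ elements, $q$ a prime power. A set system $\mathcal{S}=\{S_1,\dots,S_k\}$ is an indexed family of subsets $S_i\subseteq[n]$. A $k\times n$ matrix over $\mathbb{F}_q$ is called MDS if every $k\times k$ submatrix of it is invertible. *)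

(* Defs.v *)
From HB Require Import structures.
From mathcomp Require Import all_boot all_order all_algebra.

Set Implicit Arguments.
Unset Strict Implicit.
Unset Printing Implicit Defensive.

Import GRing.Theory.

(* A k x k submatrix of a k x n matrix keeps all k rows and selects k columns
   in increasing order, i.e. along a strictly increasing f : 'I_k -> 'I_n.
   When k > n there is no such f, so every k x n matrix is then MDS. *)
Definition is_MDS (F : fieldType) (k n : nat) (A : 'M[F]_(k, n)) : Prop :=
  forall f : 'I_k -> 'I_n,
    {homo f : i j / (i < j)%N} -> colsub f A \in unitmx.

(* Main.v *)
(* Evaluating polynomials p_0, ..., p_{k-1}, with deg p_i = i, at distinct points
   gives an MDS matrix: each maximal submatrix is an invertible triangular
   matrix of coefficients times a Vandermonde matrix.  Take as points a_j
   n elements of F, and let b be a further one, which exists because q > n.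
   Then p_i = (X - b)^(i - |S_i|) * prod_(j in S_i) (X - a_j) has degree i and
   vanishes at a_j exactly when j is in S_i. *)

Require Import Defs.
From HB Require Import structures.
From mathcomp Require Import all_boot all_order all_algebra.

Set Implicit Arguments.
Unset Strict Implicit.
Unset Printing Implicit Defensive.

Import GRing.Theory.

Lemma Vandermonde_unitmx (F : fieldType) (k : nat) (x : 'rV[F]_k) :
  injective (x 0%R) -> Vandermonde k x \in unitmx.
Proof.
move=> x_inj; rewrite unitmxE det_Vandermonde unitfE.
apply/prodf_neq0 => i _; apply/prodf_neq0 => j lt_ij.
rewrite subr_eq0; apply: contraTneq lt_ij => /x_inj ->.
by rewrite ltnn.
Qed.

Lemma eval_mx_unitmx (F : fieldType) (k : nat) (p : 'I_k -> {poly F})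
    (x : 'rV[F]_k) :
  (forall i : 'I_k, size (p i) = i.+1) -> injective (x 0%R) ->
  (\matrix_(i < k, j < k) (p i).[x 0%R j])%R \in unitmx.
Proof.
move=> size_p x_inj.
pose C : 'M[F]_k := (\matrix_(i, m) (p i)`_m)%R.
have -> : (\matrix_(i < k, j < k) (p i).[x 0 j])%R = (C *m Vandermonde k x)%R.
  apply/matrixP=> i j; rewrite !mxE (@horner_coef_wide _ k) ?size_p //.
  by apply: eq_bigr => m _; rewrite !mxE.
(* [C] is lower triangular with the nonzero leading coefficients on its diagonal. *)
rewrite unitmx_mul Vandermonde_unitmx // andbT unitmxE det_trig.
  rewrite unitfE; apply/prodf_neq0 => i _.
  have -> : C i i = lead_coef (p i) by rewrite mxE lead_coefE size_p.
  by rewrite lead_coef_eq0 -size_poly_eq0 size_p.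
by apply/is_trig_mxP => i m lt_im; rewrite mxE nth_default ?size_p.
Qed.

(* Indices are 0-based: the row numbered i in 1..k is the ordinal of value
   i - 1, so the bound |S_i| <= i - 1 reads #|S i| <= i. *)
Theorem theorem2p6 (k n : nat) (k_gt0 : (0 < k)%N) (n_gt0 : (0 < n)%N)
    (S : 'I_k -> {set 'I_n})
    (S_small : forall i : 'I_k, (#|S i| <= i)%N)
    (F : finFieldType) (F_large : (n + 1 <= #|F|)%N) :
  exists A : 'M[F]_(k, n),
    is_MDS A /\
    (forall (i : 'I_k) (j : 'I_n), A i j = 0%R <-> j \in S i).
Proof.
have lt_nF : (n < #|F|)%N by rewrite -addn1.
(* Of these n + 1 distinct elements, the last becomes [b] and the others the points [a j]. *)
pose e (i : 'I_n.+1) : F := enum_val (widen_ord lt_nF i).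
have e_inj : injective e.
  by move=> i j /enum_val_inj /(congr1 val) /= /val_inj.
pose a (j : 'I_n) := e (lift ord_max j).
have a_inj : injective a by move=> i j /e_inj /lift_inj.
pose b := e ord_max.
have a_neq_b j : a j != b by rewrite (inj_eq e_inj) eq_sym neq_lift.
pose p (i : 'I_k) : {poly F} :=
  (('X - b%:P) ^+ (i - #|S i|) * \prod_(j in S i) ('X - (a j)%:P))%R.
have size_p i : size (p i) = i.+1.
  rewrite size_monicM ?monic_exp ?monicXsubC //; last first.
    by apply/monic_neq0/monic_prod_XsubC.
  (* By [S_small] the truncated subtraction is exact, so the degrees add up to i. *)
  by rewrite size_exp_XsubC -big_enum size_prod_XsubC -cardE addSn addnS subnK.
exists (\matrix_(i, j) (p i).[a j])%R; split=> [f f_mono | i j].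
  have f_inj : injective f.
    move=> i j eq_f; apply/val_inj; case: (ltngtP i j) => // /f_mono;
    by rewrite eq_f ltnn.
  pose x : 'rV[F]_k := (\row_j a (f j))%R.
  have -> : colsub f (\matrix_(i, j) (p i).[a j])%R
            = (\matrix_(i < k, j < k) (p i).[x 0 j])%R.
    by apply/matrixP=> i j; rewrite !mxE.
  by apply: eval_mx_unitmx => // i j; rewrite !mxE => /a_inj /f_inj.
rewrite mxE hornerM horner_exp hornerXsubC horner_prod.
split=> [/eqP | Sij].
  (* The power of X - b is nonzero at [a j], so some factor indexed by [S i] vanishes. *)
  rewrite mulf_eq0 expf_eq0 subr_eq0 (negPf (a_neq_b j)) andbF /=.
  case/prodf_eq0 => l Sil.
  by rewrite hornerXsubC subr_eq0 => /eqP/a_inj ->.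
by rewrite (bigD1 j) //= hornerXsubC subrr mul0r mulr0.
Qed.
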